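(* Suppose that for all sufficiently large $t$ there is a fan-in-2 Boolean circuit of depth $O(\log t)$ that decides the $(1\ 2)(3\ 4)$-product problem over $(A_t)^t$. Then $\mathrm{NC}^1=\mathrm{L}$.
   Context: $A_t$ is the alternating group on $\{1,\ldots,t\}$ with identity $\mathrm{id}$; permutations are encoded in pointwise representation $(\sigma(1),\ldots,\sigma(t))$. For $\alpha\in A_t$, the $\alpha$-product problem over $(A_t)^t$ is: given $(x_1,\ldots,x_t)\in(A_t)^t$ promised to satisfy $x_1\cdots x_t\in\{\alpha,\mathrm{id}\}$, decide which it equals. $\mathrm{NC}^1$ is the class of polynomial-size, logarithmic-depth, fan-in-2 Boolean circuit families; $\mathrm{L}$ is logarithmic space.
   Formalization: Since NC^1 here is non-uniform and contains undecidable languages, it cannot equal uniform L; the conclusion is proved with L read as non-uniform logarithmic space L/poly (polynomial-length advice depending on the input length), which gives in particular that L is contained in NC^1. *)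

(* Defs.v *)
From HB Require Import structures.
From mathcomp Require Export all_boot all_fingroup all_solvable.

Set Implicit Arguments.
Unset Strict Implicit.
Unset Printing Implicit Defensive.

Local Open Scope nat_scope.

Definition language := seq bool -> Prop.

Definition poly_bounded (f : nat -> nat) : Prop :=
  exists k, forall n, f n <= n ^ k + k.

(** ** Fan-in-2 Boolean circuits *)

(* The wires of a circuit on n inputs are numbered: wires 0, ..., n - 1 are the
   inputs, and the k-th gate drives wire n + k.  Gates may only read wires of
   smaller number, and wires may be reused, so circuits are general DAGs.
   Constants have fan-in 0. *)
Inductive gate :=
  | GConst of bool
  | GNot of nat
  | GAnd of nat & nat
  | GOr of nat & nat.

Definition gate_ok (m : nat) (g : gate) : bool :=
  match g with
  | GConst _ => true
  | GNot i => i < m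
  | GAnd i j | GOr i j => (i < m) && (j < m)
  end.

Fixpoint gates_ok (m : nat) (gs : seq gate) : bool :=
  if gs is g :: gs' then gate_ok m g && gates_ok m.+1 gs' else true.

Record circuit (n : nat) := Circuit {
  gates : seq gate;
  output : nat;
  circuit_ok : gates_ok n gates && (output < n + size gates)
}.

Definition gate_val (v : seq bool) (g : gate) : bool :=
  match g with
  | GConst b => b
  | GNot i => ~~ nth false v i
  | GAnd i j => nth false v i && nth false v j
  | GOr i j => nth false v i || nth false v j
  end.

Definition gate_depth (d : seq nat) (g : gate) : nat :=
  match g with
  | GConst _ => 0
  | GNot i => (nth 0 d i).+1
  | GAnd i j | GOr i j => (maxn (nth 0 d i) (nth 0 d j)).+1
  end.

(* [wires f w gs] extends the list w of labels of the input wires by the labels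
   of the gates, each computed by f from the labels of the earlier wires. *)
Definition wires T (f : seq T -> gate -> T) (w : seq T) (gs : seq gate) :=
  foldl (fun w g => rcons w (f w g)) w gs.

(* Only meaningful when size x = n. *)
Definition circuit_eval n (C : circuit n) (x : seq bool) : bool :=
  nth false (wires gate_val x (gates C)) (output C).

(* The length of a longest path ending at the output. *)
Definition circuit_depth n (C : circuit n) : nat :=
  nth 0 (wires gate_depth (nseq n 0) (gates C)) (output C).

Definition circuit_size n (C : circuit n) : nat := size (gates C).

(* Circuit families are not required to be uniform. *)
Definition NC1 (A : language) : Prop :=
  exists C : forall n, circuit n,
    [/\ poly_bounded (fun n => circuit_size (C n)),
        exists c n0, forall n, n0 <= n ->
          circuit_depth (C n) <= c * trunc_log 2 n
      & forall x : seq bool, circuit_eval (C (size x)) x <-> A x].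

(** ** Logarithmic space *)

Inductive move := MoveL | Stay | MoveR.

(* A read-only tape holds a word between two end markers. *)
Inductive rosym := LEnd | Bit of bool | REnd.

Definition ro_read (w : seq bool) (i : nat) : rosym :=
  if i is j.+1 then
    if j < size w then Bit (nth false w j) else REnd
  else LEnd.

(* The head of a read-only tape never leaves the cells 0, ..., size w + 1. *)
Definition ro_move (w : seq bool) (i : nat) (m : move) : nat :=
  match m with
  | MoveL => i.-1
  | Stay => i
  | MoveR => minn i.+1 (size w).+1
  end.

Definition rw_move (i : nat) (m : move) : nat :=
  match m with MoveL => i.-1 | Stay => i | MoveR => i.+1 end.

Record transition (Q S : Type) := Transition {
  new_state : Q;
  input_move : move;
  advice_move : move;
  written : S;
  work_move : move
}.

(* Deterministic Turing machines with a two-way read-only input tape, a two-way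
   read-only advice tape and a one-way infinite read-write work tape.
   [verdict q = Some b] means that q is a halting state, accepting iff b. *)
Record machine := Machine {
  state : finType;
  symbol : finType;
  start : state;
  blank : symbol;
  verdict : state -> option bool;
  delta : state -> rosym -> rosym -> symbol -> transition state symbol
}.

Record config (M : machine) := Config {
  cstate : state M;
  input_head : nat;
  advice_head : nat;
  work_head : nat;
  work : nat -> symbol M
}.

Definition init (M : machine) : config M :=
  Config (start M) 0 0 0 (fun=> blank M).

Definition next (M : machine) (x a : seq bool) (c : config M) : config M :=
  if verdict (cstate c) is Some _ then c else
  let d := delta (cstate c) (ro_read x (input_head c))
             (ro_read a (advice_head c)) (work c (work_head c)) in
  Config (new_state d)
    (ro_move x (input_head c) (input_move d))
    (ro_move a (advice_head c) (advice_move d))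
    (rw_move (work_head c) (work_move d))
    (fun i => if i == work_head c then written d else work c i).

Definition run (M : machine) (x a : seq bool) (k : nat) : config M :=
  iter k (next x a) (init M).

(* M, given the advice word [adv (size x)] on input x, halts on all inputs and
   decides A, visiting O(log n) cells of its work tape on inputs of length n. *)
Definition logspace_decides (M : machine) (adv : nat -> seq bool)
    (A : language) : Prop :=
  (forall x : seq bool, exists k b,
     verdict (cstate (run M x (adv (size x)) k)) = Some b /\ (b <-> A x))
  /\ (exists c n0, forall x : seq bool, n0 <= size x ->
        forall k, (work_head (run M x (adv (size x)) k)).+1
                  <= c * trunc_log 2 (size x)).

(* Uniform logarithmic space. *)
Definition L_uniform (A : language) : Prop :=
  exists M : machine, logspace_decides M (fun=> [::]) A.

(* Non-uniform logarithmic space, also written L/poly: the machine receives an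
   advice word of polynomial length depending only on the input length.  This
   is the logarithmic-space class comparable with the non-uniform class [NC1],
   which contains undecidable languages. *)
Definition L_nonuniform (A : language) : Prop :=
  exists (M : machine) (adv : nat -> seq bool),
    poly_bounded (fun n => size (adv n)) /\ logspace_decides M adv A.

Lemma L_uniform_sub_nonuniform A : L_uniform A -> L_nonuniform A.
Proof. by case=> M MA; exists M, (fun=> [::]); split=> //; exists 0. Qed.

(** ** The product problem over the alternating group *)

(* The points 1, ..., t are represented by the elements 0, ..., t - 1 of 'I_t. *)

Definition bits (w m : nat) : seq bool := mkseq (fun k => odd (m %/ 2 ^ k)) w.

(* Each value sigma(j) is written with ceil(log2 t) bits, least significant
   bit first. *)
Definition perm_code t (s : 'S_t) : seq bool :=
  flatten [seq bits (up_log 2 t) (s j) | j <- enum 'I_t].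

Definition perms_code t (x : 'I_t -> 'S_t) : seq bool :=
  flatten [seq perm_code (x i) | i <- enum 'I_t].

Definition code_size (t : nat) : nat := t * (t * up_log 2 t).

Lemma size_perms_code t (x : 'I_t -> 'S_t) :
  size (perms_code x) = code_size t.
Proof.
have sz (T : Type) (f : 'I_t -> seq T) m : (forall i, size (f i) = m) ->
    size (flatten [seq f i | i <- enum 'I_t]) = t * m.
  move=> fm; rewrite size_flatten /shape -map_comp (eq_map (g := fun=> m)) //.
  rewrite sumnE big_map big_const_seq count_predT size_enum_ord iter_addn_0.
  exact: mulnC.
by apply: (sz) => i; apply: (sz) => j; rewrite size_mkseq.
Qed.

(* Nothing is required of C outside the promise. *)
Definition solves_product t (alpha : 'S_t) (C : circuit (code_size t)) : Prop :=
  forall x : 'I_t -> 'S_t,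
    (forall i, x i \in ('Alt_('I_t))%g) ->
    ((\prod_(i < t) x i)%g = alpha -> circuit_eval C (perms_code x) = true) /\
    ((\prod_(i < t) x i)%g = 1%g -> circuit_eval C (perms_code x) = false).

(* The permutation (1 2)(3 4) of t >= 4 points. *)
Definition perm12_34 t (ht : 4 <= t) : 'S_t :=
  let p (i : nat) : 'I_t := widen_ord ht (@inord 3 i) in
  (tperm (p 0%N) (p 1%N) * tperm (p 2%N) (p 3%N))%g.

Lemma perm12_34_Alt t (ht : 4 <= t) : perm12_34 ht \in ('Alt_('I_t))%g.
Proof.
by rewrite Alt_even odd_permM !odd_tperm -!val_eqE /= !inordK.
Qed.

(* Main.v *)
(* NC1 is contained in L/poly by the three-register programs of Ben-Or and
   Cleve: a circuit of logarithmic depth unfolds into a formula, the formula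
   into a polynomially long straight-line program for three bits, and a finite
   automaton can execute that program from the advice tape.

   Conversely, a computation in logarithmic space is a path in a polynomial-size
   forest, the graph of configurations paired with a clock, in which the parent
   of each vertex depends on one input bit.  A product of the transpositions of
   the edges of a tree is a single cycle on its vertices, so iterating this
   product from the initial vertex visits the root of its tree.  Counting the
   visits to accepting vertices along this walk, flipping a flag if the count is
   nonzero and then undoing the walk moves a marked point exactly when the
   machine accepts; a commutator with an involution turns this into a product
   equal to (1 2)(3 4) or to the identity.  Every factor depends on one input
   bit, so substituting literals into the formula of the given circuit decides
   the language in logarithmic depth. *)

From Stdlib Require Import ClassicalEpsilon.
Require Import Defs.
From mathcomp Require Import zify.

Set Implicit Arguments.
Unset Strict Implicit.
Unset Printing Implicit Defensive.

Local Open Scope nat_scope.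

(** * Boolean formulas *)

Inductive formula :=
  | FVar of nat
  | FConst of bool
  | FNot of formula
  | FAnd of formula & formula
  | FOr of formula & formula.

Fixpoint feval (x : seq bool) (f : formula) : bool :=
  match f with
  | FVar i => nth false x i
  | FConst b => b
  | FNot f => ~~ feval x f
  | FAnd f g => feval x f && feval x g
  | FOr f g => feval x f || feval x g
  end.

Fixpoint fdepth (f : formula) : nat :=
  match f with
  | FVar _ | FConst _ => 0
  | FNot f => (fdepth f).+1
  | FAnd f g | FOr f g => (maxn (fdepth f) (fdepth g)).+1
  end.

Fixpoint fsubst (s : seq formula) (f : formula) : formula :=
  match f with
  | FVar i => nth (FConst false) s i
  | FConst b => FConst b
  | FNot f => FNot (fsubst s f)
  | FAnd f g => FAnd (fsubst s f) (fsubst s g)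
  | FOr f g => FOr (fsubst s f) (fsubst s g)
  end.

Lemma nth_map_dflt T U (h : T -> U) a s i :
  nth (h a) (map h s) i = h (nth a s i).
Proof. by elim: s i => [|b s IH] [|i] /=. Qed.

Lemma feval_subst x s f :
  feval x (fsubst s f) = feval [seq feval x g | g <- s] f.
Proof.
elim: f => //= [i | f -> | f -> g -> | f -> g ->] //.
by rewrite -(nth_map_dflt (feval x) (FConst false)).
Qed.

Lemma fdepth_subst d s f :
  all (fun g => fdepth g <= d) s -> fdepth (fsubst s f) <= fdepth f + d.
Proof.
move=> /all_nthP sd.
elim: f => //= [i | f IHf g IHg | f IHf g IHg]; try lia.
by have [lt_i | ge_i] := ltnP i (size s); [apply: sd | rewrite nth_default].
Qed.

(** Each bit of the code of a permutation chosen by one input bit is a function of that bit: a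
    constant, the variable or its negation. *)
Definition literal (i : nat) (b0 b1 : bool) : formula :=
  if b0 == b1 then FConst b0 else if b1 then FVar i else FNot (FVar i).

Lemma feval_literal x i b0 b1 :
  feval x (literal i b0 b1) = if nth false x i then b1 else b0.
Proof. by rewrite /literal; case: b0 b1 => -[] /=; case: nth. Qed.

Lemma fdepth_literal i b0 b1 : fdepth (literal i b0 b1) <= 1.
Proof. by case: b0 b1 => -[]. Qed.

(** * Unfolding circuits into formulas and back *)

Lemma wires_cat T (f : seq T -> gate -> T) w gs gs' :
  wires f w (gs ++ gs') = wires f (wires f w gs) gs'.
Proof. exact: foldl_cat. Qed.

Lemma size_wires T (f : seq T -> gate -> T) w gs :
  size (wires f w gs) = size w + size gs.
Proof.
elim: gs w => [|g gs IH] w /=; first by rewrite addn0.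
by rewrite /wires /= -/(wires f _ gs) IH size_rcons addSnnS.
Qed.

Lemma nth_wires T (f : seq T -> gate -> T) a w gs i :
  i < size w -> nth a (wires f w gs) i = nth a w i.
Proof.
elim: gs w => //= g gs IH w lt_i.
by rewrite /wires /= -/(wires f _ gs) IH ?size_rcons 1?ltnW // nth_rcons lt_i.
Qed.

Lemma wires_last T (f : seq T -> gate -> T) a w gs g :
  nth a (wires f w (rcons gs g)) (size w + size gs) = f (wires f w gs) g.
Proof.
by rewrite -cats1 wires_cat /= nth_rcons size_wires ltnn eqxx.
Qed.

Lemma map_wires T U (h : T -> U) f f' w gs :
  (forall w g, h (f w g) = f' (map h w) g) ->
  map h (wires f w gs) = wires f' (map h w) gs.
Proof.
move=> hf; elim: gs w => //= g gs IH w.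
by rewrite /wires /= -/(wires f _ gs) IH map_rcons hf.
Qed.

Definition gate_formula (s : seq formula) (g : gate) : formula :=
  let v := nth (FConst false) s in
  match g with
  | GConst b => FConst b
  | GNot i => FNot (v i)
  | GAnd i j => FAnd (v i) (v j)
  | GOr i j => FOr (v i) (v j)
  end.

(** Shared gates are duplicated, so the size may grow exponentially in the depth; only the depth is
    controlled from here on. *)
Definition circuit_formula n (C : circuit n) : formula :=
  nth (FConst false) (wires gate_formula (mkseq FVar n) (gates C)) (output C).

Lemma feval_circuit_formula n (C : circuit n) x :
  size x = n -> feval x (circuit_formula C) = circuit_eval C x.
Proof.
move=> sx; rewrite /circuit_formula -(nth_map_dflt (feval x)).
rewrite (@map_wires _ _ _ _ gate_val) -?map_comp.
  by rewrite (_ : [seq _ | _ <- _] = x) // -sx; apply: mkseq_nth.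
by move=> w [b|i|i j|i j] /=; rewrite // -!(nth_map_dflt (feval x)).
Qed.

Lemma fdepth_circuit_formula n (C : circuit n) :
  fdepth (circuit_formula C) = circuit_depth C.
Proof.
rewrite /circuit_formula -(nth_map_dflt fdepth).
rewrite (@map_wires _ _ _ _ gate_depth) -?map_comp.
  rewrite (_ : [seq _ | _ <- _] = nseq n 0) //.
  by apply: (@eq_from_nth _ 0) => [|i]; rewrite size_map size_iota ?size_nseq //
     => lt_i; rewrite nth_nseq lt_i (nth_map 0) ?size_iota.
by move=> w [b|i|i j|i j] /=; rewrite // -!(nth_map_dflt fdepth).
Qed.

(* The gates computing [f] on top of [m >= n] existing wires, together with the
   wire that carries the value. *)
Fixpoint compile (n m : nat) (f : formula) : seq gate * nat :=
  match f with
  | FVar i => if i < n then ([::], i) else ([:: GConst false], m)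
  | FConst b => ([:: GConst b], m)
  | FNot f => let: (gs, o) := compile n m f in
      (rcons gs (GNot o), m + size gs)
  | FAnd f g => let: (gs, o) := compile n m f in
      let: (hs, p) := compile n (m + size gs) g in
      (rcons (gs ++ hs) (GAnd o p), m + size (gs ++ hs))
  | FOr f g => let: (gs, o) := compile n m f in
      let: (hs, p) := compile n (m + size gs) g in
      (rcons (gs ++ hs) (GOr o p), m + size (gs ++ hs))
  end.

Lemma gates_ok_cat m gs hs :
  gates_ok m (gs ++ hs) = gates_ok m gs && gates_ok (m + size gs) hs.
Proof.
elim: gs m => [|g gs IH] m /=; first by rewrite addn0.
by rewrite IH addSnnS andbA.
Qed.

Lemma compile_ok n m f : n <= m ->
  gates_ok m (compile n m f).1 /\
  (compile n m f).2 < m + size (compile n m f).1.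
Proof.
elim: f m => /= [i|b|f IHf|f IHf g IHg|f IHf g IHg] m nm /=; try by lia.
- by case: ltnP => /=; lia.
- case: (compile n m f) (IHf m nm) => gs o /= [ok lt_o].
  by rewrite -cats1 gates_ok_cat ok size_cat /= lt_o; lia.
- case: (compile n m f) (IHf m nm) => gs o /= [ok lt_o].
  case: (compile n _ g) (IHg (m + size gs) ltac:(lia)) => hs p /= [ok' lt_p].
  by rewrite -cats1 !gates_ok_cat ok ok' !size_cat /=; lia.
- case: (compile n m f) (IHf m nm) => gs o /= [ok lt_o].
  case: (compile n _ g) (IHg (m + size gs) ltac:(lia)) => hs p /= [ok' lt_p].
  by rewrite -cats1 !gates_ok_cat ok ok' !size_cat /=; lia.
Qed.

Lemma size_compile n m f : size (compile n m f).1 < 2 ^ (fdepth f).+1.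
Proof.
elim: f m => /= [i|b|f IHf|f IHf g IHg|f IHf g IHg] m //=.
- by case: (i < n).
- case: (compile n m f) (IHf m) => gs o /=.
  by rewrite size_rcons !expnS; lia.
- case: (compile n m f) (IHf m) => gs o /=.
  case: (compile n _ g) (IHg (m + size gs)) => hs p /=.
  rewrite size_rcons size_cat.
  have := leq_pexp2l (isT : 0 < 2) (leq_maxl (fdepth f) (fdepth g)).
  have := leq_pexp2l (isT : 0 < 2) (leq_maxr (fdepth f) (fdepth g)).
  by rewrite !expnS; lia.
- case: (compile n m f) (IHf m) => gs o /=.
  case: (compile n _ g) (IHg (m + size gs)) => hs p /=.
  rewrite size_rcons size_cat.
  have := leq_pexp2l (isT : 0 < 2) (leq_maxl (fdepth f) (fdepth g)).
  have := leq_pexp2l (isT : 0 < 2) (leq_maxr (fdepth f) (fdepth g)).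
  by rewrite !expnS; lia.
Qed.

Section CompileLabel.

Variables (T : Type) (a : T) (lab : seq T -> gate -> T) (sem : formula -> T).
Variables (n : nat) (w0 : seq T).
Hypothesis sem_var : forall i, i < n -> sem (FVar i) = nth a w0 i.
Hypothesis sem_out : forall i w, n <= i -> sem (FVar i) = lab w (GConst false).
Hypothesis sem_const : forall b w, sem (FConst b) = lab w (GConst b).
Hypothesis sem_not : forall f w i,
  sem f = nth a w i -> sem (FNot f) = lab w (GNot i).
Hypothesis sem_and : forall f g w i j, sem f = nth a w i ->
  sem g = nth a w j -> sem (FAnd f g) = lab w (GAnd i j).
Hypothesis sem_or : forall f g w i j, sem f = nth a w i ->
  sem g = nth a w j -> sem (FOr f g) = lab w (GOr i j).

(** One induction covers both depth and value, as instances of [lab] and [sem]. The list [w] may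
    extend the input labels, since the second subformula is compiled on top of the first. *)
Lemma compile_label f w : n <= size w ->
  (forall i, i < n -> nth a w i = nth a w0 i) ->
  nth a (wires lab w (compile n (size w) f).1) (compile n (size w) f).2 = sem f.
Proof.
elim: f w => /= [i|b|f IHf|f IHf g IHg|f IHf g IHg] w nw ww0.
- have [lt_i|ge_i] /= := ltnP i n; first by rewrite ww0 // sem_var.
  by rewrite nth_rcons ltnn eqxx -(sem_out _ ge_i).
- by rewrite nth_rcons ltnn eqxx -sem_const.
- case: (compile n _ f) (IHf w nw ww0) => gs o /= fo.
  by rewrite wires_last; apply/esym/sem_not.
- have [_] := compile_ok f nw.
  case: (compile n _ f) (IHf w nw ww0) => gs o /= fo lt_o.
  have := IHg (wires lab w gs); rewrite size_wires.
  case: (compile n _ g) => hs p /= gp.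
  rewrite wires_last wires_cat; apply/esym/sem_and.
    by rewrite nth_wires ?size_wires.
  rewrite gp //; first by lia.
  by move=> i lt_i; rewrite nth_wires ?ww0 //; lia.
- have [_] := compile_ok f nw.
  case: (compile n _ f) (IHf w nw ww0) => gs o /= fo lt_o.
  have := IHg (wires lab w gs); rewrite size_wires.
  case: (compile n _ g) => hs p /= gp.
  rewrite wires_last wires_cat; apply/esym/sem_or.
    by rewrite nth_wires ?size_wires.
  rewrite gp //; first by lia.
  by move=> i lt_i; rewrite nth_wires ?ww0 //; lia.
Qed.

End CompileLabel.

Lemma formula_circuit n f : exists C : circuit n,
  [/\ circuit_size C < 2 ^ (fdepth f).+1,
      circuit_depth C = fdepth f
    & forall x, size x = n -> circuit_eval C x = feval x f].
Proof.
have [ok lt_o] := compile_ok f (leqnn n).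
have okC : gates_ok n (compile n n f).1 &&
    ((compile n n f).2 < n + size (compile n n f).1) by rewrite ok.
exists (Circuit okC); split=> [||x sx]; first exact: size_compile.
- rewrite /circuit_depth /=.
  have := @compile_label _ 0 gate_depth fdepth n (nseq n 0) _ _ _ _ _ _ f.
  move/(_ _ _ _ _ _ _ (nseq n 0)); rewrite size_nseq; apply=> //=.
  + by move=> i lt_i; rewrite nth_nseq lt_i.
  + by move=> g w i ->.
  + by move=> g h w i j -> ->.
  + by move=> g h w i j -> ->.
- rewrite /circuit_eval /=.
  have := @compile_label _ false gate_val (feval x) n x _ _ _ _ _ _ f.
  move/(_ _ _ _ _ _ _ x); rewrite sx; apply=> //=.
  + by move=> i _; rewrite -sx => ?; rewrite nth_default.
  + by move=> g w i ->.
  + by move=> g h w i j -> ->.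
  + by move=> g h w i j -> ->.
Qed.

Lemma ltn_log2 n : n < 2 ^ (trunc_log 2 n).+1.
Proof. exact: trunc_log_ltn. Qed.

Lemma log2_gt0 n : 1 < n -> 0 < trunc_log 2 n.
Proof. by move=> n_gt1; rewrite trunc_log_gt0. Qed.

Lemma poly_bounded_log (f : nat -> nat) e n0 :
  (forall n, n0 <= n -> f n <= 2 ^ (e * trunc_log 2 n)) -> poly_bounded f.
Proof.
(* [m] absorbs the finitely many [n <= n0]; beyond them [n] is positive, so
   [2 ^ trunc_log 2 n <= n]. *)
move=> fe; pose m := \max_(i < n0.+1) f i; exists (e + m + 1) => n.
have [lt_n|ge_n] := ltnP n n0.+1.
  by have := @leq_bigmax 'I_n0.+1 f (Ordinal lt_n); rewrite -/m /=; lia.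
apply: leq_trans (fe n (ltnW ge_n)) _; rewrite mulnC expnM.
apply: leq_trans (leq_addr _ _).
apply: (@leq_trans (n ^ e)); last by rewrite leq_pexp2l //; lia.
by case: e {fe} => // e; rewrite leq_exp2r // trunc_logP //; lia.
Qed.

(** * From formulas to branching programs *)

(* Straight-line programs for three one-bit registers and a head on the input:
   [inl b] moves the head, and [inr (i, j, c)] adds register [i] to register
   [j] modulo 2, multiplied by the scanned input bit if [c] holds. *)
Notation op := (bool + 'I_3 * 'I_3 * bool)%type.

Notation regs := {ffun 'I_3 -> bool}.

Definition add_to (j : 'I_3) (b : bool) (r : regs) : regs :=
  [ffun l => r l (+) ((l == j) && b)].

Definition op_move (o : op) : move :=
  match o with inl true => MoveR | inl false => MoveL | inr _ => Stay end.

Definition exec (o : op) (s : rosym) (r : regs) : regs :=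
  match o with
  | inl _ => r
  | inr (i, j, c) =>
      add_to j (r i && (c ==> if s is Bit b then b else false)) r
  end.

Definition run_op (x : seq bool) (s : nat * regs) (o : op) : nat * regs :=
  (ro_move x s.1 (op_move o), exec o (ro_read x s.1) s.2).

(* Ben-Or and Cleve: if i, j, k are distinct, the program adds register [i]
   times the value of [f] to register [j] and preserves the other two. *)
Fixpoint prog (n : nat) (i j k : 'I_3) (f : formula) : seq op :=
  match f with
  | FVar v => if v < n then
      nseq v.+1 (inl true) ++ inr (i, j, true) :: nseq v.+1 (inl false)
      else [::]
  | FConst b => if b then [:: inr (i, j, false)] else [::]
  | FNot f => inr (i, j, false) :: prog n i j k f
  | FAnd f g =>
      let p := prog n i k j f in let q := prog n k j i g in p ++ q ++ p ++ q
  | FOr f g =>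
      let p := prog n i k j f in let q := prog n k j i g in
      prog n i j k f ++ prog n i j k g ++ p ++ q ++ p ++ q
  end.

Lemma run_op_right x r h m : h + m <= (size x).+1 ->
  foldl (run_op x) (h, r) (nseq m (inl true)) = (h + m, r).
Proof.
elim: m h => [|m IH] h hm /=; first by rewrite addn0.
by rewrite /run_op /= IH (minn_idPl _) ?addSnnS //; lia.
Qed.

Lemma run_op_left x r h m :
  foldl (run_op x) (h, r) (nseq m (inl false)) = (h - m, r).
Proof.
elim: m h => [|m IH] h /=; first by rewrite subn0.
by rewrite /run_op /= IH; congr pair; lia.
Qed.

Lemma add_to_neq i j a r : i != j -> add_to j a r i = r i.
Proof. by move=> /negPf ij; rewrite ffunE ij addbF. Qed.

Lemma add_to0 j r : add_to j false r = r.
Proof. by apply/ffunP => l; rewrite ffunE andbF addbF. Qed.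

Lemma add_to_add j a b r : add_to j b (add_to j a r) = add_to j (a (+) b) r.
Proof. by apply/ffunP => l; rewrite !ffunE; case: eqP; rewrite ?addbF ?addbA. Qed.

(** Register k receives [r i && a] twice and is restored. With i, j, k for the initial contents,
    register j receives (k + ia)b and then kb, which add up to iab modulo 2. *)
Lemma add_to_and (i j k : 'I_3) a b (r : regs) : uniq [:: i; j; k] ->
  let r1 := add_to k (r i && a) r in let r2 := add_to j (r1 k && b) r1 in
  let r3 := add_to k (r2 i && a) r2 in
  add_to j (r3 k && b) r3 = add_to j (r i && (a && b)) r.
Proof.
rewrite /= !inE negb_or !andbT => /andP[/andP[ij ik] jk].
have kj : k != j by rewrite eq_sym.
rewrite (add_to_neq _ _ ij) (add_to_neq _ _ ik); apply/ffunP => l.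
rewrite !ffunE (negPf kj) !eqxx /= addbF.
have [->|lj] /= := eqVneq l j; rewrite ?(negPf jk) /= ?addbF.
  by case: (r i) (r j) (r k) a b => -[] [] [] [].
by case: (l == k) (r l) (r i) a => -[] [] [].
Qed.

Lemma uniq3_perm (T : eqType) (i j k : T) :
  uniq [:: i; j; k] -> uniq [:: i; k; j] /\ uniq [:: k; j; i].
Proof.
rewrite /= !inE !negb_or !andbT => /andP[/andP[ij ik] jk].
by rewrite ![k == _]eq_sym [j == i]eq_sym ij ik jk.
Qed.

Lemma run_prog x (i j k : 'I_3) f (r : regs) : uniq [:: i; j; k] ->
  foldl (run_op x) (0, r) (prog (size x) i j k f)
  = (0, add_to j (r i && feval x f) r).
Proof.
elim: f i j k r => [v|b|f IHf|f IHf g IHg|f IHf g IHg] i j k r ijk.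
- rewrite /prog; have [lt_v|ge_v] := ltnP v (size x).
    (* Bit v sits in cell v + 1, since cell 0 holds the left end marker. *)
    rewrite foldl_cat run_op_right ?add0n; last by lia.
    have -> s (o : op) q : foldl (run_op x) s (o :: q)
        = foldl (run_op x) (run_op x s o) q by [].
    by rewrite /run_op [exec _ _ _]/= lt_v run_op_left subnn.
  by rewrite /= nth_default // andbF add_to0.
- by case: b; rewrite /= ?/run_op /= ?andbT ?andbF ?add_to0.
- have ij : i != j by move: ijk; rewrite /= inE negb_or; case: (i != j).
  rewrite /= /run_op /= IHf // add_to_neq // add_to_add.
  by case: (r i) (feval x f) => -[].
- have [ikj kji] := uniq3_perm ijk.
  by rewrite /= !foldl_cat !(IHf _ _ _ _ ikj, IHg _ _ _ _ kji) add_to_and.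
- have [ikj kji] := uniq3_perm ijk.
  have ij : i != j by move: ijk; rewrite /= inE negb_or; case: (i != j).
  rewrite /= !foldl_cat IHf // IHg //.
  rewrite !(IHf _ _ _ _ ikj, IHg _ _ _ _ kji) add_to_and //.
  (* Modulo 2, the disjunction of a and b is a + b + ab. *)
  rewrite !add_to_add !add_to_neq //.
  by case: (r i) (feval x f) (feval x g) => -[] [].
Qed.

(** A leaf costs a trip to its bit and back. A level multiplies the bound by at most 6, the number
    of recursive programs in a disjunction, and [2 ^ 3] covers this. *)
Lemma size_prog n i j k f :
  size (prog n i j k f) <= (n.*2).+1 * 2 ^ (3 * fdepth f).
Proof.
elim: f i j k => [v|b|f IHf|f IHf g IHg|f IHf g IHg] i j k;
  rewrite [prog _ _ _ _ _]/= [fdepth _]/=.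
- case: ifP => // lt_v; rewrite -cat_cons size_cat [size (_ :: _)]/=.
  by rewrite !size_nseq muln0 expn0 /= ?size_nseq; lia.
- by case: b; rewrite muln0 expn0 muln1.
- have := IHf i j k; rewrite [size (_ :: _)]/= mulnS expnD mulnCA.
  have : 0 < n.*2.+1 * 2 ^ (3 * fdepth f) by rewrite muln_gt0 expn_gt0.
  rewrite (_ : 2 ^ 3 = 8) //; lia.
- have [ef eg] : 2 ^ (3 * fdepth f) <= 2 ^ (3 * maxn (fdepth f) (fdepth g)) /\
                 2 ^ (3 * fdepth g) <= 2 ^ (3 * maxn (fdepth f) (fdepth g)).
    by split; rewrite leq_pexp2l //; lia.
  rewrite !size_cat mulnS expnD (_ : 2 ^ 3 = 8) //.
  have := IHf i k j; have := IHg k j i.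
  move: (2 ^ _) (2 ^ _) (2 ^ _) ef eg => u v w *; nia.
- have [ef eg] : 2 ^ (3 * fdepth f) <= 2 ^ (3 * maxn (fdepth f) (fdepth g)) /\
                 2 ^ (3 * fdepth g) <= 2 ^ (3 * maxn (fdepth f) (fdepth g)).
    by split; rewrite leq_pexp2l //; lia.
  rewrite !size_cat mulnS expnD (_ : 2 ^ 3 = 8) //.
  have := IHf i k j; have := IHg k j i.
  have := IHf i j k; have := IHg i j k.
  move: (2 ^ _) (2 ^ _) (2 ^ _) ef eg => u v w *; nia.
Qed.

(** * A finite automaton executing the program from the advice tape *)

(* The advice encodes the operation of index m by m zeros and a one.  The second
   component of an unfinished state counts the zeros read so far. *)
Definition encode_op (o : op) : seq bool :=
  rcons (nseq (index o (enum {: op})) false) true.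

Definition reg_state : finType := (regs * 'I_(#|{: op}|.+1) + bool)%type.

Definition reg_delta (q : reg_state) (s a : rosym) (_ : unit) :
    transition reg_state unit :=
  match q, a with
  | inr b, _ => Transition (inr b) Stay Stay tt Stay
  | inl (r, p), LEnd => Transition (inl (r, p)) Stay MoveR tt Stay
  | inl (r, p), Bit false => Transition (inl (r, inord p.+1)) Stay MoveR tt Stay
  | inl (r, p), Bit true =>
      let o := nth (inl true) (enum {: op}) p in
      Transition (inl (exec o s r, ord0)) (op_move o) MoveR tt Stay
  | inl (r, p), REnd => Transition (inr (r (inord 1))) Stay Stay tt Stay
  end.

(** Register 0 starts at 1 and the others at 0, so adding register 0 times the value of a formula to
    register 1 leaves that value in register 1, which is the verdict. *)
Definition reg_machine : machine :=
  @Machine reg_state unit (inl ([ffun l => l == ord0], ord0)) tt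
    (fun q => if q is inr b then Some b else None) reg_delta.

Definition reg_at (c : config reg_machine) (r : regs) (p h a : nat) : Prop :=
  [/\ exists2 p' : 'I_(#|{: op}|.+1), p = p' & cstate c = inl (r, p'),
      input_head c = h & advice_head c = a].

Lemma ro_read_cat a b a' : ro_read (a ++ b :: a') (size a).+1 = Bit b.
Proof.
by rewrite /= size_cat /= -[X in X < _]addn0 ltn_add2l nth_cat ltnn subnn.
Qed.

Lemma ro_move_cat a b a' :
  ro_move (a ++ b :: a') (size a).+1 MoveR = (size (a ++ [:: b])).+1.
Proof. by rewrite /= !size_cat addn1; apply/minn_idPl; rewrite /=; lia. Qed.

Lemma reg_zeros x m a a' c r p h : p + m <= #|{: op}| ->
  reg_at c r p h (size a).+1 ->
  reg_at (iter m (next x (a ++ nseq m false ++ a')) c) r (p + m) h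
    (size (a ++ nseq m false)).+1.
Proof.
elim: m a c p => [|m IH] a c p pm cP; first by rewrite cats0 addn0.
rewrite iterSr /= -cat_rcons -[in X in reg_at _ _ _ _ X]cat_rcons.
rewrite -addSnnS; apply: IH; first by lia.
case: cP => -[p' pp' qc] hc ac; rewrite /next qc /= ac hc.
rewrite -cats1 -catA [_ ++ _]/= ro_read_cat /=; split=> //=.
  by exists (inord p.+1); rewrite ?inordK ?pp' //; lia.
by rewrite -[minn _ _]/(ro_move _ _ MoveR) ro_move_cat.
Qed.

Lemma reg_op x o a a' c r h : reg_at c r 0 h (size a).+1 ->
  exists k, reg_at (iter k (next x (a ++ encode_op o ++ a')) c)
    (run_op x (h, r) o).2 0 (run_op x (h, r) o).1
    (size (a ++ encode_op o)).+1.
Proof.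
set m := index o (enum {: op}).
have lt_m : m < #|{: op}| by rewrite cardE index_mem mem_enum.
move=> /(@reg_zeros x m a (true :: a') _ _ 0 _ (ltnW lt_m)) cP.
exists m.+1; rewrite iterS /encode_op -/m -cats1 -!catA [[:: true] ++ _]/=.
move: cP; rewrite !catA add0n; case: (iter _ _ _) => q ih ah wh w.
case=> -[p' mp' /= ->] -> ->; rewrite /next.
rewrite -[cstate _]/(inl (r, p') : reg_state).
rewrite -[advice_head _]/(size (a ++ nseq m false)).+1 ro_read_cat /= -mp'.
rewrite nth_index ?mem_enum //; split=> //=; first by exists ord0.
by rewrite -[minn _ _]/(ro_move _ _ MoveR) ro_move_cat.
Qed.

Lemma reg_ops x os a a' c r h : reg_at c r 0 h (size a).+1 ->
  exists k, reg_at (iter k (next x (a ++ flatten (map encode_op os) ++ a')) c)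
    (foldl (run_op x) (h, r) os).2 0 (foldl (run_op x) (h, r) os).1
    (size (a ++ flatten (map encode_op os))).+1.
Proof.
elim: os a c r h => [|o os IH] a c r h cP; first by exists 0; rewrite cats0.
have [k1 {}cP] := reg_op x o (flatten (map encode_op os) ++ a') cP.
have [k2 {}cP] := IH _ _ _ _ cP.
exists (k2 + k1); rewrite iterD /= -!catA; rewrite -!catA in cP.
by rewrite (surjective_pairing (run_op x (h, r) o)).
Qed.

Lemma reg_work_head x a k : work_head (run reg_machine x a k) = 0.
Proof.
elim: k => //= k; rewrite /run /=; case: (iter k _ _) => q ih ah wh w /= ->.
rewrite /next /=; case: q => [[r p]|b] //=.
by case: (ro_read a ah) => [|[]|].
Qed.

Definition reg_advice (n : nat) (f : formula) : seq bool :=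
  flatten (map encode_op (prog n ord0 (inord 1) (inord 2) f)).

Lemma reg_machine_verdict x f :
  exists k, verdict (cstate (run reg_machine x (reg_advice (size x) f) k))
            = Some (feval x f).
Proof.
set a := reg_advice _ _.
pose r : regs := [ffun l => l == ord0].
have c1P : reg_at (next x a (init reg_machine)) r 0 0 (size (Nil bool)).+1.
  by split=> //=; [exists ord0 | apply/minn_idPl].
have [k] := reg_ops x (prog (size x) ord0 (inord 1) (inord 2) f) [::] c1P.
rewrite cats0 -/(reg_advice (size x) f) -/a run_prog; last first.
  by rewrite /= !inE -!val_eqE /= !inordK.
(* Besides the k steps of the program, one step leaves the left end marker of the advice tape and
   one reacts to the right end marker. *)
case=> -[p _ qc] hc ac; exists k.+2; rewrite /run iterS iterSr.
case: (iter _ _ _) qc hc ac => q ih ah wh w /= -> -> ->.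
by rewrite /next /= ltnn /= !ffunE !eqxx -val_eqE /= inordK.
Qed.

Lemma size_reg_advice n f :
  size (reg_advice n f) <= #|{: op}|.+1 * (n.*2.+1 * 2 ^ (3 * fdepth f)).
Proof.
have le_o o : size (encode_op o) <= #|{: op}|.+1.
  by rewrite size_rcons size_nseq ltnS cardE index_size.
apply: leq_trans (leq_mul (leqnn _) (size_prog n ord0 (inord 1) (inord 2) f)).
rewrite /reg_advice; elim: prog => [|o os IH] //=.
by rewrite size_cat mulnS leq_add.
Qed.

Lemma NC1_sub_L A : NC1 A -> L_nonuniform A.
Proof.
case=> C [_ [c [n0 dC]] CA].
pose F n := circuit_formula (C n).
exists reg_machine, (fun n => reg_advice n (F n)); split; last first.
  split=> [x|].
    have [k kP] := reg_machine_verdict x (F (size x)).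
    exists k, (feval x (F (size x))); split=> //.
    by rewrite feval_circuit_formula.
  by exists 1, 2 => x x_gt1 k; rewrite reg_work_head mul1n log2_gt0.
(* The three summands bound the three factors in [size_reg_advice]: the length of an encoded
   operation, 2n + 1, and the power of 2 given by the depth. *)
apply: (@poly_bounded_log _ (#|{: op}|.+1 + 3 + 3 * c) (n0 + 2)) => n n0n.
have l_gt0 : 0 < trunc_log 2 n by apply: log2_gt0; lia.
apply: leq_trans (size_reg_advice _ _) _.
set l := trunc_log 2 n in l_gt0 *.
have -> : (#|{: op}|.+1 + 3 + 3 * c) * l =
    #|{: op}|.+1 * l + (3 * l + 3 * (c * l)) by lia.
rewrite [2 ^ (_ + _)]expnD [2 ^ (3 * l + _)]expnD; apply: leq_mul.
  apply: (@leq_trans (2 ^ #|{: op}|.+1)); first exact/ltnW/ltn_expl.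
  by rewrite leq_pexp2l // leq_pmulr.
apply: leq_mul.
  have := ltn_log2 n; have := leq_pexp2l (isT : 0 < 2) l_gt0.
  by rewrite -/l (mulnC 3) expnM !expnS; move: (2 ^ l) => u; nia.
rewrite leq_pexp2l // leq_mul2l /= fdepth_circuit_formula dC //; lia.
Qed.

(** * The cycles of a product of the transpositions of a tree *)

Lemma mem_porbit1 (T : finType) (p : {perm T}) x : p x \in porbit p x.
Proof. by have := mem_porbit p 1 x; rewrite expg1. Qed.

Lemma iter_ltn_card (T : finType) (f : T -> T) i x :
  exists2 k, k < #|T| & iter k f x = iter i f x.
Proof.
have fx := fconnect_iter f i x.
exists (findex f x (iter i f x)); rewrite ?iter_findex //.
exact: leq_trans (findex_max fx) (max_card _).
Qed.

Section TreeCycle.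

Variables (D : finType) (f : D -> D) (rk : D -> nat).
Hypothesis f_rk : forall v, f v = v \/ rk v < rk (f v).

(** By [f_rk] the graph of [f] is a forest whose roots are the fixed points. Decreasing rank puts
    every parent before its children. *)
Definition rk_enum : seq D := sort (fun u v => rk v <= rk u) (enum D).

Definition tree_perm : {perm D} := (\prod_(v <- rk_enum) tperm v (f v))%g.

(** Right multiplication by [tperm v w] inserts the fixed point [v] into the cycle of [w]: the
    former preimage of [w] now goes to [v], and [v] to [w]. *)
Lemma porbit_mul_tperm (p : {perm D}) v w : p v = v ->
  w \in porbit (p * tperm v w)%g v /\
  forall x y, y \in porbit p x -> y \in porbit (p * tperm v w)%g x.
Proof.
move=> pv; set q := (p * tperm v w)%g.
have qv : q v = w by rewrite permM pv tpermL.
split=> [|x y]; first by rewrite -qv mem_porbit1.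
have px u : p u \in porbit q u.
  have [puv|npuv] := eqVneq (p u) v.
    by rewrite puv -(perm_inj (etrans puv (esym pv))) porbit_id.
  have [puw|npuw] := eqVneq (p u) w; last first.
    by rewrite -[p u](tpermD (x := v) (y := w)) 1?eq_sym // -permM mem_porbit1.
  have q2u : (q ^+ 2)%g u = w by rewrite permX /= [q u]permM puw tpermR qv.
  by rewrite puw -{1}q2u mem_porbit.
case/porbitP=> i ->; elim: i => [|i IH]; first by rewrite expg0 perm1 porbit_id.
by rewrite expgSr permM; move: (IH); rewrite -eq_porbit_mem => /eqP<-; apply: px.
Qed.

(* The transposition of v with its parent f v comes after those of the vertices
   of higher rank, so it inserts the new point v into the cycle of f v. *)
Lemma f_porbit_tree_perm v : f v \in porbit tree_perm v.
Proof.
have : v \in rk_enum by rewrite mem_sort mem_enum.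
have : uniq rk_enum by rewrite sort_uniq enum_uniq.
have : pairwise (fun u v => rk v <= rk u) rk_enum.
  rewrite -sorted_pairwise; last by move=> ? ? ? /[swap]; apply: leq_trans.
  by apply: sort_sorted => a b; apply: leq_total.
rewrite /tree_perm; elim/last_ind: rk_enum v => // e u IH v.
rewrite pairwise_rcons rcons_uniq big_rcons /=.
move=> /andP[/allP ue epw] /andP[uNe euniq].
set p := (\prod_(_ <- e) _)%g in IH *.
(* No earlier factor [tperm w (f w)] moves [u]: [w] differs from [u] by uniqueness, and [f w = u]
   would give [u] a higher rank than [w], against the sorting. *)
have pu : p u = u.
  rewrite /p; elim: (e) ue uNe => [|w e' IHe] ue; first by rewrite big_nil perm1.
  rewrite inE negb_or big_cons permM => /andP[uw uNe'].
  rewrite tpermD ?IHe //; first by move=> a ae; apply: ue; rewrite inE ae orbT.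
    by rewrite eq_sym.
  have := ue w (mem_head _ _); case: (f_rk w) => [->|]; first by rewrite eq_sym.
  by case: eqP => // ->; lia.
have [uf mono] := porbit_mul_tperm (f u) pu.
rewrite mem_rcons inE => /predU1P[-> //|ve].
exact/mono/IH.
Qed.

Lemma iter_porbit_tree_perm j v : iter j f v \in porbit tree_perm v.
Proof.
elim: j => [|j IH]; first exact: porbit_id.
move: IH; rewrite -eq_porbit_mem => /eqP<-; exact: f_porbit_tree_perm.
Qed.

(** Each factor only swaps a vertex with its parent. Applied to the map from a vertex to its root,
    this confines the walk to one tree. *)
Lemma tree_perm_invariant U (h : D -> U) v :
  (forall v, h (f v) = h v) -> h (tree_perm v) = h v.
Proof.
move=> hf; rewrite /tree_perm; elim: rk_enum v => [|u e IH] v.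
  by rewrite big_nil perm1.
by rewrite big_cons permM IH; case: tpermP => // ->; rewrite hf.
Qed.

End TreeCycle.

(** * Programs of permutations *)

(* The instruction (i, p) applies the permutation [p b], where b is the i-th
   input bit. *)
Notation perm_prog T := (seq (nat * (bool -> {perm T}))).

Section PermProg.

Local Open Scope group_scope.

Variable T : finType.
Implicit Types P Q : perm_prog T.

Definition perm_val (x : seq bool) P : {perm T} :=
  \prod_(w <- P) w.2 (nth false x w.1).

Definition perm_cst (p : {perm T}) : nat * (bool -> {perm T}) :=
  (0%N, fun=> p).

Definition perm_prog_map (U : finType) (h : {perm T} -> {perm U}) P :
    perm_prog U :=
  [seq (w.1, fun b => h (w.2 b)) | w <- P].

Definition perm_prog_inv P : perm_prog T :=
  rev (perm_prog_map (fun p => p^-1) P).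

Lemma perm_val_nil x : perm_val x [::] = 1.
Proof. exact: big_nil. Qed.

Lemma perm_val_cons x w P :
  perm_val x (w :: P) = w.2 (nth false x w.1) * perm_val x P.
Proof. exact: big_cons. Qed.

Lemma perm_val_cat x P Q : perm_val x (P ++ Q) = perm_val x P * perm_val x Q.
Proof. exact: big_cat. Qed.

Lemma perm_val_inv x P : perm_val x (perm_prog_inv P) = (perm_val x P)^-1.
Proof.
elim: P => [|w P IH]; first by rewrite /perm_prog_inv perm_val_nil invg1.
rewrite /perm_prog_inv /= rev_cons -cats1 perm_val_cat -/(perm_prog_inv P) IH.
by rewrite !perm_val_cons perm_val_nil mulg1 invMg.
Qed.

Lemma perm_val_iter x n P :
  perm_val x (flatten (nseq n P)) = perm_val x P ^+ n.
Proof.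
elim: n => [|n IH] /=; first by rewrite perm_val_nil expg0.
by rewrite perm_val_cat IH expgS.
Qed.

End PermProg.

Lemma perm_val_map x (T U : finType) (h : {perm T} -> {perm U}) P :
  h 1%g = 1%g -> {morph h : p q / (p * q)%g} ->
  perm_val x (perm_prog_map h P) = h (perm_val x P).
Proof. by move=> h1 hM; rewrite /perm_val big_map (big_morph h hM h1). Qed.

Section OnFst.

Local Open Scope group_scope.

Variables T U : finType.

Fact on_fst_inj (p : {perm T}) : injective (fun y : T * U => (p y.1, y.2)).
Proof. by move=> [a b] [c d] /= [/perm_inj-> ->]. Qed.

Definition on_fst (p : {perm T}) : {perm T * U} := perm (@on_fst_inj p).

Lemma on_fst1 : on_fst 1 = 1.
Proof. by apply/permP=> -[a b]; rewrite permE !perm1. Qed.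

Lemma on_fstM : {morph on_fst : p q / p * q}.
Proof. move=> p q; apply/permP=> y.
by rewrite [RHS]permM ![on_fst _ _]permE /= permM. Qed.

End OnFst.

(** * Testing the root of a vertex *)

Lemma leq_sum_bool n (a : nat -> bool) : \sum_(i < n) a i <= n.
Proof.
rewrite -[X in _ <= X]card_ord -sum1_card.
by apply: leq_sum => i _; apply: leq_b1.
Qed.

Section RootTest.

Variables (D : finType) (rk : D -> nat) (acc : pred D).
Variables (F : D -> nat * (bool -> D)) (J : nat).

(** Each input selects a forest. Below, [parent_root] says that [J] steps reach the root, and
    [F_acc] makes accepting vertices roots for every input. *)
Definition parent (x : seq bool) (v : D) : D :=
  (F v).2 (nth false x (F v).1).

Hypothesis F_rk : forall v b, (F v).2 b = v \/ rk v < rk ((F v).2 b).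
Hypothesis F_acc : forall v b, acc v -> (F v).2 b = v.
Hypothesis parent_root : forall x v,
  parent x (iter J (parent x) v) = iter J (parent x) v.

(* The second component counts the visits to accepting vertices. *)
Notation counted := (D * ('I_#|D|.+2 * bool))%type.

(** The order of the factors depends on the rank alone, not on the input, so one program serves the
    forests of all inputs. *)
Definition tree_prog : perm_prog counted :=
  [seq ((F v).1, fun b => on_fst _ (tperm v ((F v).2 b))) | v <- rk_enum rk].

Lemma perm_val_tree x :
  perm_val x tree_prog = on_fst _ (tree_perm (parent x) rk).
Proof.
rewrite /perm_val big_map /tree_perm.
by rewrite (big_morph _ (@on_fstM D ('I_#|D|.+2 * bool)%type) (on_fst1 _ _)).
Qed.

Definition visit_fun (y : counted) : counted :=
  (y.1, (if acc y.1 then ordS y.2.1 else y.2.1, y.2.2)).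

Fact visit_inj : injective visit_fun.
Proof.
by move=> [d [m b]] [d' [m' b']] [/= <-]; case: ifP => _ => [/ordS_inj|] -> ->.
Qed.

Definition flag_fun (y : counted) : counted :=
  (y.1, (y.2.1, y.2.2 (+) (y.2.1 != ord0))).

Fact flag_funK : involutive flag_fun.
Proof. by move=> [d [m b]]; rewrite /flag_fun /= -addbA addbb addbF. Qed.

Definition flag : {perm counted} := perm (inv_inj flag_funK).

Definition step_prog : perm_prog counted :=
  perm_cst (perm visit_inj) :: tree_prog.

(** A walk of [#|D|] steps exhausts the cycle of its starting vertex. *)
Definition walk_prog : perm_prog counted := flatten (nseq #|D| step_prog).

Definition test_prog : perm_prog counted :=
  walk_prog ++ perm_cst flag :: perm_prog_inv walk_prog.

Lemma size_test_prog : size test_prog = 2 * (#|D| * #|D|.+1) + 1.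
Proof.
have sw : size walk_prog = #|D| * #|D|.+1.
  rewrite /walk_prog size_flatten /shape map_nseq sumn_nseq /= size_map.
  by rewrite size_sort -cardE mulnC.
by rewrite size_cat /= size_rev size_map sw addnS addn1 mul2n addnn.
Qed.

Lemma perm_val_step x d m b :
  perm_val x step_prog (d, (m, b)) =
  (tree_perm (parent x) rk d, (if acc d then ordS m else m, b)).
Proof. by rewrite perm_val_cons permM perm_val_tree !permE. Qed.

Lemma perm_val_steps x n d b : n <= #|D| ->
  let p := tree_perm (parent x) rk in
  (perm_val x step_prog ^+ n)%g (d, (ord0, b)) =
  (iter n p d, (inord (\sum_(i < n) acc (iter i p d)), b)).
Proof.
move=> nD /=; set p := tree_perm _ _; elim: n nD => [|n IH] nD.
  rewrite big_ord0 expg0 perm1; congr (_, (_, _)).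
  by apply/val_inj; rewrite /= inordK.
rewrite expgSr permM IH 1?ltnW // perm_val_step -/p big_ord_recr /=.
congr (_, (_, _)); have /= le_n := leq_sum_bool n (fun i => acc (iter i p d)).
case: ifP => _; last by rewrite addn0.
(* The count is at most [#|D|], so [ordS] does not wrap around to 0. *)
have le_D := leq_trans le_n (ltnW nD).
by apply/val_inj; rewrite /= !inordK ?addn1 ?modn_small // !ltnS // leqW.
Qed.

(** An accepting vertex on the walk is a root in the tree of [v], hence the root of [v]. Conversely
    that root lies on the cycle of [v], which the walk exhausts. *)
Lemma perm_val_test x v b :
  perm_val x test_prog (v, (ord0, b)) =
  (v, (ord0, b (+) acc (iter J (parent x) v))).
Proof.
rewrite perm_val_cat perm_val_cons perm_val_inv !permM perm_val_iter.
set p := tree_perm (parent x) rk; set W := (perm_val x step_prog ^+ _)%g.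
apply: (canLR (permK W)); rewrite !perm_val_steps //= permE /flag_fun /=.
congr (_, (_, _ (+) _)).
have /= le_n := leq_sum_bool #|D| (fun i => acc (iter i p v)).
have px u : parent x u = u \/ rk u < rk (parent x u) by apply: F_rk.
rewrite -val_eqE /= inordK; last by rewrite ltnS leqW.
rewrite sum_nat_eq0 negb_forall; apply/existsP/idP => [[i]|acc_v].
  rewrite eqb0 negbK => acc_i.
  have := acc_i; have <- : iter J (parent x) (iter i p v) = iter i p v.
    by elim: J => //= j ->; apply: F_acc.
  pose h u := iter J (parent x) u.
  have hf u : h (parent x u) = h u by rewrite /h -iterSr iterS parent_root.
  rewrite -/(h _) -/(h v); suff -> : h (iter i p v) = h v by [].
  by elim: (nat_of_ord i) => //= j <-; apply: tree_perm_invariant.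
have /porbitP[i] := iter_porbit_tree_perm px J v.
rewrite permX => iP; have [k lt_k kP] := iter_ltn_card p i v.
by exists (Ordinal lt_k); rewrite eqb0 negbK /= kP -iP.
Qed.

(** The test is a conjugate of the involution [flag]. *)
Lemma perm_val_test2 x : (perm_val x test_prog * perm_val x test_prog = 1)%g.
Proof.
rewrite perm_val_cat perm_val_cons perm_val_inv.
set W := perm_val x walk_prog; rewrite /= !mulgA mulgKV.
rewrite -[(_ * flag * flag)%g]mulgA (_ : flag * flag = 1)%g ?mulg1 ?mulgV //.
by apply/permP=> y; rewrite permM !permE flag_funK.
Qed.

End RootTest.

(** * Reduction to the product problem *)

(** Used to relabel points so that the final double transposition is exactly (1 2)(3 4). *)
Lemma perm_map_seq (T : finType) (s s' : seq T) :
  uniq s -> uniq s' -> size s = size s' -> exists p : {perm T}, map p s = s'.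
Proof.
elim: s s' => [|a s IH] [|a' s'] //=; first by exists 1%g.
move=> /andP[as_ us] /andP[as' us'] [/(IH _ us us') [p ps]].
exists (p * tperm (p a) a')%g; rewrite permM tpermL; congr cons.
rewrite -[RHS]ps; apply/eq_in_map => u us0; rewrite permM tpermD //.
  by apply: contraNneq as_ => /perm_inj->.
by apply: contraNneq as' => ->; rewrite -ps map_f.
Qed.

Lemma tperm_commute (T : finType) (a b c d : T) :
  a != c -> a != d -> b != c -> b != d -> commute (tperm a b) (tperm c d).
Proof.
by move=> ac ad bc bd; apply/commgP/conjg_fixP; rewrite tpermJ !tpermD // eq_sym.
Qed.

Section Double.

Variables (Y : finType) (t : nat).
Variables (e : Y * bool -> 'I_t) (e' : 'I_t -> Y * bool).
Hypotheses (eK : cancel e e') (e'K : cancel e' e).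

Fact double_inj (p : {perm Y}) :
  injective (fun i => e (p (e' i).1, (e' i).2)).
Proof.
move=> i j /(can_inj eK) [/perm_inj eq1 eq2]; apply: (can_inj e'K).
by rewrite [e' i]surjective_pairing eq1 eq2 -surjective_pairing.
Qed.

(** Acting on two copies of [Y] at once makes every permutation even, as the alternating group
    demands. *)
Definition double (p : {perm Y}) : 'S_t := perm (@double_inj p).

Lemma doubleE p y b : double p (e (y, b)) = e (p y, b).
Proof. by rewrite permE eK. Qed.

Lemma double1 : double 1%g = 1%g.
Proof.
apply/permP=> i; rewrite -[i]e'K; case: (e' i) => y b.
by rewrite doubleE !perm1.
Qed.

Lemma doubleM : {morph double : p q / (p * q)%g}.
Proof.
move=> p q; apply/permP=> i; rewrite -[i]e'K; case: (e' i) => y b.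
by rewrite permM !doubleE permM.
Qed.

Lemma double_tperm y z : double (tperm y z) =
  (tperm (e (y, false)) (e (z, false)) * tperm (e (y, true)) (e (z, true)))%g.
Proof.
have e_eq u v : (e u == e v) = (u == v) by apply/inj_eq/can_inj/eK.
apply/permP=> i; rewrite -[i]e'K; case: (e' i) => w b; rewrite doubleE permM.
have e_inj c : injective (fun u => e (u, c)) by move=> u v /(can_inj eK) [].
case: b.
  rewrite [tperm (e (y, false)) _ _]tpermD ?e_eq ?xpair_eqE ?andbF //.
  exact: (inj_tperm y z w (e_inj true)).
have /= <- := inj_tperm y z w (e_inj false).
by rewrite [RHS]tpermD ?e_eq ?xpair_eqE ?andbF.
Qed.

Lemma double_even p : double p \in ('Alt_('I_t))%g.
Proof.
have e_eq u v : (e u == e v) = (u == v) by apply/inj_eq/can_inj/eK.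
rewrite Alt_even; have [ts -> _] := prod_tpermP p.
rewrite (big_morph _ doubleM double1); elim: ts => [|u ts IH].
  by rewrite big_nil odd_perm1.
rewrite big_cons odd_permM (negPf IH) addbF double_tperm odd_permM !odd_tperm.
by rewrite !e_eq !xpair_eqE !andbT addbb.
Qed.

(** Since [double g] is an involution, the word is [d] times its conjugate by [double g].
    Conjugation carries the transposition at [y] to [g y] and fixes the one at [z], so the two at
    [z] cancel; their presence makes [d] even. *)
Lemma swap_word (g : {perm Y}) (y z : Y) : (g * g = 1)%g -> g z = z ->
  y != z -> g y != z ->
  let d := (tperm (e (y, false)) (e (y, true)) *
            tperm (e (z, false)) (e (z, true)))%g in
  (d * double g * (d * double g) =
   tperm (e (y, false)) (e (y, true)) *
   tperm (e (g y, false)) (e (g y, true)))%g.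
Proof.
move=> gg gz yz gyz d; have e_eq u v : (e u == e v) = (u == v).
  by apply/inj_eq/can_inj/eK.
have GV : double g = ((double g)^-1)%g.
  by apply/eqP; rewrite eq_sym eq_invg_mul -doubleM gg double1.
rewrite -mulgA {1}GV -conjgE conjMg !tpermJ.
rewrite !doubleE gz {}/d; set tz := tperm (e (z, _)) _.
rewrite -[RHS]mulg1 -(tperm2 (e (z, false)) (e (z, true))) -/tz -!mulgA.
congr (_ * _)%g; rewrite !mulgA; congr (_ * _)%g.
by apply: tperm_commute; rewrite e_eq xpair_eqE eq_sym negb_and ?gyz.
Qed.

End Double.

(** The vertex [z], whose root never accepts, supplies the point fixed by the test that [swap_word]
    requires. *)
Lemma root_test_program (D : finType) (rk : D -> nat) (acc : pred D)
    (F : D -> nat * (bool -> D)) (J : nat) (s z : D) t (ht : 4 <= t) :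
  (forall v b, (F v).2 b = v \/ rk v < rk ((F v).2 b)) ->
  (forall v b, acc v -> (F v).2 b = v) ->
  (forall x v, parent F x (iter J (parent F x) v) = iter J (parent F x) v) ->
  s != z -> (forall x, ~~ acc (iter J (parent F x) z)) ->
  t = 4 * (#|D| * #|D|.+2) ->
  exists P : perm_prog 'I_t,
  [/\ size P <= t, all (fun w => [forall b, w.2 b \in ('Alt_('I_t))%g]) P
    & forall x, perm_val x P =
        if acc (iter J (parent F x) s) then perm12_34 ht else 1%g].
Proof.
move=> F_rk F_acc F_root sz zacc tE.
pose Y : finType := (D * ('I_#|D|.+2 * bool))%type.
pose y b : Y := (s, (ord0, b)); pose y1 : Y := (z, (ord0, false)).
(* The points are vertex, counter, flag and copy, and the last two account for the factor 4. *)
have cardX : #|{: Y * bool}| = t by rewrite !card_prod card_ord card_bool tE; lia.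
pose e0 (u : Y * bool) : 'I_t := cast_ord cardX (enum_rank u).
pose e0' (i : 'I_t) : Y * bool := enum_val (cast_ord (esym cardX) i).
have e0K : cancel e0 e0' by move=> u; rewrite /e0' cast_ordK enum_rankK.
have e0'K : cancel e0' e0 by move=> u; rewrite /e0 enum_valK cast_ordKV.
pose p4 (i : nat) : 'I_t := widen_ord ht (@inord 3 i).
have [q qE] : exists q : 'S_t, map q [:: e0 (y false, false); e0 (y false, true);
    e0 (y true, false); e0 (y true, true)] = [:: p4 0; p4 1; p4 2; p4 3].
  apply: perm_map_seq => //; last by rewrite /= !inE -!val_eqE /= !inordK.
  rewrite -[X in uniq X]/(map e0 [:: _; _; _; _]) (map_inj_uniq (can_inj e0K)).
  by rewrite /= !inE /y !xpair_eqE /= !andbF.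
pose e u := q (e0 u); pose e' i := e0' ((q^-1)%g i).
have eK : cancel e e' by move=> u; rewrite /e' permK.
have e'K : cancel e' e by move=> u; rewrite /e e0'K permKV.
case: qE => e00 e01 e10 e11.
pose d : 'S_t := (tperm (e (y false, false)) (e (y false, true)) *
  tperm (e (y1, false)) (e (y1, true)))%g.
pose P := perm_cst d :: perm_prog_map (double eK e'K) (test_prog rk acc F).
exists (P ++ P); split=> [||x].
(* With N = [#|D|], the program has 4(N(N + 1) + 1) instructions, at most 4N(N + 2) because N >
   0. *)
- rewrite size_cat /= size_map size_test_prog tE.
  have : 0 < #|D| by apply/card_gt0P; exists s.
  by move: #|D| => N; nia.
- have d_even : d \in ('Alt_('I_t))%g.
    rewrite Alt_even odd_permM !odd_tperm !(inj_eq (can_inj eK)).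
    by rewrite !xpair_eqE /= !andbF.
  rewrite all_cat andbb /= all_map; apply/andP; split; first exact/forallP.
  rewrite (eq_all (a2 := predT)) ?all_predT // => w.
  by apply/forallP=> b; apply: double_even.
rewrite perm_val_cat perm_val_cons perm_val_map; [|exact: double1|exact: doubleM].
set g := perm_val x _.
have gE v b : g (v, (ord0, b)) = (v, (ord0, b (+) acc (iter J (parent F x) v))).
  exact: perm_val_test.
rewrite swap_word ?gE //.
(* If the root accepts, [g] flips the flag and the word is (1 2)(3 4); otherwise the same
   transposition occurs twice and cancels. *)
- rewrite addFb; case: ifP => _; last exact: tperm2.
  by rewrite /e -/(y true) e00 e01 e10 e11.
- exact: perm_val_test2.
- by rewrite addFb (negPf (zacc x)).
- by rewrite xpair_eqE (negPf sz).
- by rewrite xpair_eqE (negPf sz).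
Qed.

(** * From permutation programs to circuits of logarithmic depth *)

Lemma size_perm_code t (s : 'S_t) : size (perm_code s) = t * up_log 2 t.
Proof.
rewrite /perm_code size_flatten /shape -map_comp.
rewrite (eq_map (g := fun=> up_log 2 t)); last by move=> j; apply: size_mkseq.
by rewrite sumnE big_map big_const_seq count_predT size_enum_ord iter_addn_0 mulnC.
Qed.

(** The instance is the list of instruction values, padded with identities to length [t]. Its bits
    are literals, which add at most 1 to the depth, and [Pval] and [Peven] guarantee the promise. *)
Lemma program_formula t (ht : 4 <= t) (C : circuit (code_size t))
    (P : perm_prog 'I_t) (a : pred (seq bool)) :
  solves_product (perm12_34 ht) C -> size P <= t ->
  all (fun w => [forall b, w.2 b \in ('Alt_('I_t))%g]) P ->
  (forall x, perm_val x P = if a x then perm12_34 ht else 1%g) ->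
  exists2 f, fdepth f <= circuit_depth C + 1 & forall x, feval x f = a x.
Proof.
move=> Csol szP Peven Pval; pose w i := nth (perm_cst 1%g) P i.
pose code i := [seq literal (w i).1 (nth false (perm_code ((w i).2 false)) k)
    (nth false (perm_code ((w i).2 true)) k) | k <- iota 0 (t * up_log 2 t)].
pose s := flatten [seq code (nat_of_ord i) | i <- enum 'I_t].
exists (fsubst s (circuit_formula C)) => [|x].
  rewrite -fdepth_circuit_formula; apply: fdepth_subst.
  rewrite /s; elim: (enum _) => //= i l IH; rewrite all_cat IH andbT all_map.
  by apply/allP => k _; apply: fdepth_literal.
rewrite feval_subst.
pose y (i : 'I_t) : 'S_t := (w i).2 (nth false x (w i).1).
have -> : [seq feval x g | g <- s] = perms_code y.
  rewrite /s map_flatten -map_comp; congr flatten; apply: eq_map => i /=.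
  rewrite -map_comp; apply: (@eq_from_nth _ false) => [|k].
    by rewrite size_map size_iota size_perm_code.
  rewrite size_map size_iota => lt_k; rewrite (nth_map 0) ?size_iota //=.
  by rewrite nth_iota // feval_literal /y; case: nth.
have y_even i : y i \in ('Alt_('I_t))%g.
  rewrite /y /w; have [lt_i|ge_i] := ltnP i (size P).
    by have /all_nthP-/(_ (perm_cst 1%g) i lt_i)/forallP := Peven; apply.
  by rewrite nth_default //= group1.
have y_prod : (\prod_(i < t) y i)%g = perm_val x P.
  rewrite /perm_val (big_nth (perm_cst 1%g)).
  rewrite -(big_mkord xpredT (fun i => (w i).2 (nth false x (w i).1))).
  rewrite (big_cat_nat (leq0n _) szP) /= [X in (_ * X)%g = _]big1_seq ?mulg1 //.
  move=> i /=; rewrite mem_index_iota => /andP[ge_i _].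
  by rewrite /w nth_default.
have [yes no] := Csol y y_even.
rewrite feval_circuit_formula ?size_perms_code //.
by move: yes no; rewrite y_prod Pval; case: (a x) => [/(_ erefl)|_ /(_ erefl)].
Qed.

(** Serves the finitely many lengths below a threshold, where depth does not matter. The suffix [y]
    lets a formula for the first n bits be reused on a longer word when branching on bit n. *)
Lemma formula_complete (A : language) n :
  exists f, forall x y, size x = n -> (feval (x ++ y) f <-> A x).
Proof.
elim: n A => [|n IH] A.
  have [A0|nA0] := excluded_middle_informative (A [::]).
    by exists (FConst true) => x y /size0nil->.
  by exists (FConst false) => x y /size0nil->.
have [f fP] := IH (fun x => A (rcons x true)).
have [g gP] := IH (fun x => A (rcons x false)).
exists (FOr (FAnd (FVar n) f) (FAnd (FNot (FVar n)) g)).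
move=> x y; case/lastP: x => // x b; rewrite size_rcons => -[sx].
rewrite cat_rcons /= nth_cat sx ltnn subnn /=.
by case: b => /=; rewrite ?orbF; [apply: fP | apply: gP].
Qed.

Lemma NC1_of_formulas (A : language) c n0 :
  (forall n, n0 <= n -> exists2 f, fdepth f <= c * trunc_log 2 n &
     forall x, size x = n -> (feval x f <-> A x)) -> NC1 A.
Proof.
move=> FA.
have CA n : exists C : circuit n, (n0 <= n ->
    circuit_depth C <= c * trunc_log 2 n /\
    circuit_size C < 2 ^ (c * trunc_log 2 n).+1) /\
    forall x, size x = n -> (circuit_eval C x <-> A x).
  have [le_n|gt_n] := leqP n0 n.
    have [f df fA] := FA n le_n; have [C [sC dC CE]] := formula_circuit n f.
    exists C; split=> [_|x sx]; last by rewrite CE // fA.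
    by rewrite dC df; split=> //; apply: leq_trans sC _; rewrite leq_pexp2l.
  have [f fA] := formula_complete A n; have [C [_ _ CE]] := formula_circuit n f.
  exists C; split=> // x sx; rewrite CE //.
  by have := fA x [::] sx; rewrite cats0.
pose C n := sval (constructive_indefinite_description _ (CA n)).
have CP n := svalP (constructive_indefinite_description _ (CA n)).
exists C; split=> [||x]; last by apply: (CP _).2.
  (* The extra 1 in [c.+1] absorbs the successor in the exponent of the size bound. *)
  apply: (@poly_bounded_log _ c.+1 (n0 + 2)) => n le_n.
  have [|_ sC] := (CP n).1; first by lia.
  apply: leq_trans (ltnW sC) _; rewrite leq_pexp2l // mulSn.
  by have : 0 < trunc_log 2 n by [apply: log2_gt0; lia]; lia.
by exists c, n0 => n /(CP n).1 [].
Qed.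

(** * Configuration graphs *)

Section ConfigGraph.

Variables (M : machine) (a : seq bool) (n s : nat).

Definition fconfig : finType :=
  (state M * ('I_n.+2 * 'I_(size a).+2) *
   ('I_s.+1 * {ffun 'I_s.+1 -> symbol M}))%type.

(** Only the first s + 1 work cells are kept, and head positions are faithful only under [fits]. *)
Definition fencode (c : config M) : fconfig :=
  (cstate c, (inord (input_head c), inord (advice_head c)),
   (inord (work_head c), [ffun i : 'I_s.+1 => work c i])).

Definition fdecode (c : fconfig) : config M :=
  Config c.1.1 c.1.2.1 c.1.2.2 c.2.1
    (fun i => if i < s.+1 then c.2.2 (inord i) else blank M).

(** Bit j lies in cell j + 1. At an end marker the selected bit has no influence on the step. *)
Definition finput (c : fconfig) : nat := c.1.2.1.-1.

(* A step reads at most one input bit b, so it can be simulated on any input of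
   length n which carries b at the scanned position. *)
Definition fstep (c : fconfig) (b : bool) : fconfig :=
  fencode (next (nseq n b) a (fdecode c)).

Definition fnext (x : seq bool) (c : fconfig) : fconfig :=
  fstep c (nth false x (finput c)).

Definition fits (c : config M) : Prop :=
  [/\ input_head c <= n.+1, advice_head c <= (size a).+1 & work_head c <= s].

Lemma ro_read_nseq x i :
  size x = n -> ro_read (nseq n (nth false x i.-1)) i = ro_read x i.
Proof.
move=> sx; case: i => //= i; rewrite size_nseq sx.
by case: ltnP => // lt_i; rewrite nth_nseq lt_i.
Qed.

Lemma ro_move_size w w' i m :
  size w = size w' -> ro_move w i m = ro_move w' i m.
Proof. by move=> sw; case: m; rewrite //= sw. Qed.

Lemma ro_move_le w i m : i <= (size w).+1 -> ro_move w i m <= (size w).+1.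
Proof. by case: m => //= le_i; lia. Qed.

Lemma fnext_encode x c : size x = n -> fits c ->
  fnext x (fencode c) = fencode (next x a c).
Proof.
move=> sx [ic ac wc]; rewrite /fnext /fstep /finput /fencode /fdecode /next /=.
rewrite !inordK // ?ltnS // wc ffunE inordK ?ltnS // ro_read_nseq //.
case: verdict => [b|] /=.
  congr (_, (_, _)).
  by apply/ffunP => i; rewrite !ffunE ltn_ord inord_val.
rewrite (@ro_move_size _ x) ?size_nseq //; congr (_, (_, _)).
apply/ffunP => i; rewrite !ffunE /=; case: eqP => // _.
by rewrite ltn_ord inord_val.
Qed.

Variable x : seq bool.
Hypothesis size_x : size x = n.
Hypothesis space : forall k, work_head (run M x a k) <= s.

Lemma run_fits k : fits (run M x a k).
Proof.
elim: k => [|k [ik ak wk]]; first by split.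
split; last exact: space.
all: rewrite /run iterS /next; case: verdict => // /=; rewrite -/(run M x a k).
  by rewrite -size_x in ik *; apply: ro_move_le.
exact: ro_move_le.
Qed.

Lemma iter_fnext k :
  iter k (fnext x) (fencode (init M)) = fencode (run M x a k).
Proof.
elim: k => //= k ->; rewrite fnext_encode //; exact: run_fits.
Qed.

Lemma run_halted k j b : verdict (cstate (run M x a k)) = Some b -> k <= j ->
  verdict (cstate (run M x a j)) = Some b.
Proof.
move=> vb /subnK<-; elim: (j - k) => // i IH.
by rewrite addSn /run iterS /next -/(run M x a (i + k)) IH.
Qed.

(** By pigeonhole the halting configuration already occurs within [#|fconfig|] steps, and a halted
    machine stays put. *)
Lemma run_halts_card k b : verdict (cstate (run M x a k)) = Some b ->
  verdict (cstate (run M x a #|fconfig|)) = Some b.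
Proof.
move=> vb; have [j lt_j] := iter_ltn_card (fnext x) k (fencode (init M)).
rewrite !iter_fnext => -[eq_q _ _ _ _].
by apply: run_halted (ltnW lt_j); rewrite eq_q.
Qed.

End ConfigGraph.

Arguments fconfig : simpl never.

(** * The clocked configuration graph as a forest *)

Section LayeredGraph.

Variables (M : machine) (a : seq bool) (n s pad : nat).

Notation T := #|fconfig M a n s|.

(* Besides the configurations with a clock there are isolated vertices: they
   provide a point fixed by the test and make the number of points exceed the
   threshold t0. *)
Notation vertex := (fconfig M a n s * 'I_T.+1 + 'I_pad.+1)%type.

(** The clock ticks even after the machine has halted, so every edge between distinct vertices
    raises the rank and a clocked vertex is a root only at time [T]. *)
Definition edge (v : vertex) : nat * (bool -> vertex) :=
  match v with
  | inl (c, i) => if i < T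
      then (finput c, fun b => inl (fstep c b, inord i.+1))
      else (0, fun=> inl (c, i))
  | inr i => (0, fun=> inr i)
  end.

Definition vrank (v : vertex) : nat := if v is inl (_, i) then i else 0.

(** Requiring clock [T] makes accepting vertices roots. Nothing is lost, as a halting run has halted
    by then. *)
Definition vaccept (v : vertex) : bool :=
  if v is inl (c, i) then (i == T :> nat) && (verdict c.1.1 == Some true)
  else false.

Lemma edge_rank v b : (edge v).2 b = v \/ vrank v < vrank ((edge v).2 b).
Proof.
case: v => [[c i]|i] /=; last by left.
by case: ltnP => lt_i /=; [right; rewrite inordK | left].
Qed.

Lemma edge_accept v b : vaccept v -> (edge v).2 b = v.
Proof. by case: v => [[c i]|i] //= /andP[/eqP-> _]; rewrite ltnn. Qed.

Lemma iter_parent_inr x j i : iter j (parent edge x) (inr i) = inr i.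
Proof. by elim: j => //= j ->. Qed.

Lemma iter_parent x c j : j <= T ->
  iter j (parent edge x) (inl (c, ord0)) = inl (iter j (fnext x) c, inord j).
Proof.
elim: j => [_|j IH lt_j] /=.
  by congr (inl (_, _)); apply/val_inj; rewrite /= inordK.
by rewrite IH 1?ltnW // /parent /= inordK ?lt_j // ltnS ltnW.
Qed.

Lemma iter_parent_root x v :
  parent edge x (iter T (parent edge x) v) = iter T (parent edge x) v.
Proof.
case: v => [[c i]|i]; last by rewrite iter_parent_inr.
have [c' [i' [-> le_i]]] : exists c' (i' : 'I_T.+1),
    iter T (parent edge x) (inl (c, i)) = inl (c', i') /\ T <= i'.
  (* Invariant: after j steps from any vertex with a clock, the clock shows at least the minimum of
     [T] and j. *)
  suff /(_ T) [c' [i' [-> le_i]]] j : exists c' (i' : 'I_T.+1),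
      iter j (parent edge x) (inl (c, i)) = inl (c', i') /\ minn T j <= i'.
    by exists c', i'; rewrite minnn in le_i.
  elim: j => [|j [c' [i' [IH le_i]]]]; first by exists c, i; rewrite minn0.
  rewrite /= IH /parent /=; case: ltnP => lt_i /=.
    exists (fnext x c'), (inord i'.+1); split=> //; move: le_i.
    by rewrite inordK // !geq_min ltnS => /orP[/leqW|] ->; rewrite ?orbT.
  by exists c', i'; split=> //; apply: leq_trans lt_i; apply: geq_minl.
by rewrite /parent /= ltnNge le_i.
Qed.

Lemma card_vertex : #|{: vertex}| = T * T.+1 + pad.+1.
Proof. by rewrite card_sum card_prod !card_ord. Qed.

Lemma machine_program (A : language) t (ht : 4 <= t) :
  (forall x, size x = n -> exists k b,
     verdict (cstate (run M x a k)) = Some b /\ (b <-> A x)) ->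
  (forall x, size x = n -> forall k, work_head (run M x a k) <= s) ->
  t = 4 * ((T * T.+1 + pad.+1) * (T * T.+1 + pad.+1).+2) ->
  exists (P : perm_prog 'I_t) (r : pred (seq bool)),
  [/\ size P <= t, all (fun w => [forall b, w.2 b \in ('Alt_('I_t))%g]) P,
      forall x, perm_val x P = if r x then perm12_34 ht else 1%g
    & forall x, size x = n -> (r x <-> A x)].
Proof.
move=> MA space tE.
pose s0 : vertex := inl (fencode a n s (init M), ord0).
pose r x := vaccept (iter T (parent edge x) s0).
(* The isolated vertex [inr ord0] is its own root and does not accept. *)
have [||||||P [szP Peven Pval]] := @root_test_program _ vrank vaccept edge T s0
  (inr ord0) t ht.
- exact: edge_rank.
- exact: edge_accept.
- exact: iter_parent_root.
- by [].
- by move=> x; rewrite iter_parent_inr.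
- by rewrite card_vertex.
exists P, r; split=> // x sx; rewrite /r iter_parent //= inordK // eqxx /=.
rewrite iter_fnext //; last exact: space.
have [k [b [vb <-]]] := MA x sx.
by rewrite /= (run_halts_card sx (space x sx) vb); case: b {vb}.
Qed.

End LayeredGraph.

(** * Logarithmic space in NC1 *)

(** Polynomial growth, phrased so that taking logarithms turns depth O(log f(n)) into O(log n). *)
Definition pow_log (f : nat -> nat) : Prop :=
  exists e n0, forall n, n0 <= n -> f n <= 2 ^ (e * trunc_log 2 n).

Lemma pow_log_const k : pow_log (fun=> k).
Proof.
exists k, 2 => n n_gt1; apply: leq_trans (ltnW (ltn_expl k (isT : 1 < 2))) _.
by rewrite leq_pexp2l // leq_pmulr // log2_gt0.
Qed.

Lemma pow_log_id : pow_log id.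
Proof.
exists 2, 2 => n n_gt1; apply: leq_trans (ltnW (ltn_log2 n)) _.
by rewrite leq_pexp2l //; have := log2_gt0 n_gt1; lia.
Qed.

Lemma pow_logM f g : pow_log f -> pow_log g -> pow_log (fun n => f n * g n).
Proof.
move=> [d [n0 fd]] [e [n1 ge]]; exists (d + e), (n0 + n1) => n le_n.
by rewrite mulnDl expnD leq_mul ?fd ?ge //; lia.
Qed.

Lemma pow_logD f g : pow_log f -> pow_log g -> pow_log (fun n => f n + g n).
Proof.
move=> [d [n0 fd]] [e [n1 ge]]; exists (d + e + 1), (n0 + n1 + 2) => n le_n.
have l_gt0 : 0 < trunc_log 2 n by apply: log2_gt0; lia.
apply: leq_trans (leq_add (fd n _) (ge n _)) _; try lia.
set l := trunc_log 2 n in l_gt0 *.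
have -> : (d + e + 1) * l = d * l + e * l + l by lia.
rewrite 2!expnD.
have u_gt0 : 0 < 2 ^ (d * l) by rewrite expn_gt0.
have v_gt0 : 0 < 2 ^ (e * l) by rewrite expn_gt0.
apply: leq_trans (leq_mul (leqnn _) (leq_pexp2l (isT : 0 < 2) l_gt0)).
by rewrite expn1 muln2 -addnn leq_add // ?leq_pmulr // leq_pmull.
Qed.

Lemma pow_logX f k : pow_log f -> pow_log (fun n => f n ^ k).
Proof.
move=> fp; elim: k => [|k IH]; first exact: pow_log_const.
by have [e [n0 feP]] := pow_logM fp IH; exists e, n0 => n /feP; rewrite expnS.
Qed.

(** It suffices to bound the base [k] by [2 ^ k]. *)
Lemma pow_log_explog k c : pow_log (fun n => k ^ (c * trunc_log 2 n)).
Proof.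
exists (k * c), 0 => n _; rewrite -mulnA [X in _ <= X]expnM.
by case: (c * _) => // m; rewrite leq_exp2r // ltnW // ltn_expl.
Qed.

Lemma pow_log_le f g : (forall n, f n <= g n) -> pow_log g -> pow_log f.
Proof.
move=> fg [e [n0 gP]]; exists e, n0 => n le_n.
exact: leq_trans (fg n) (gP n le_n).
Qed.

Lemma pow_log_poly f : poly_bounded f -> pow_log f.
Proof.
case=> k fk; apply: pow_log_le fk _.
by apply: pow_logD (pow_log_const k); apply/pow_logX/pow_log_id.
Qed.

Lemma L_sub_NC1 (A : language) :
  (exists c t0 : nat, forall (t : nat) (ht : 4 <= t), t0 <= t ->
     exists C : circuit (code_size t),
       circuit_depth C <= c * trunc_log 2 t /\
       solves_product (perm12_34 ht) C) ->
  L_nonuniform A -> NC1 A.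
Proof.
move=> [c [t0 prodC]] [M [adv [advP [MA [cs [n0 space]]]]]].
pose s n := (cs * trunc_log 2 n).-1.
pose T n := #|fconfig M (adv n) n (s n)|.
(* Padding with t0 + 1 isolated vertices makes [t n] exceed the threshold [t0]. *)
pose N n := T n * (T n).+1 + t0.+1.
pose t n := 4 * (N n * (N n).+2).
have [e [n1 te]] : pow_log t.
  have Tp : pow_log T.
    (* The factors bound the numbers of states, positions of the two read-only heads, work head
       positions and work tape contents. *)
    apply: (@pow_log_le _ (fun n =>
        #|state M| * ((n + 2) * (size (adv n) + 2)) *
        ((2 ^ (cs * trunc_log 2 n) + 1) *
         (#|symbol M| ^ (cs * trunc_log 2 n) * #|symbol M|)))) => [n|].
      have le_s : (s n).+1 <= cs * trunc_log 2 n + 1 by rewrite /s; lia.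
      rewrite /T !card_prod card_ffun !card_ord !addn2 leq_mul2l.
      apply/orP; right; apply: leq_mul.
        by apply: leq_trans le_s _; rewrite leq_add2r ltnW // ltn_expl.
      rewrite -expnSr -[X in _ <= _ ^ X]addn1 leq_pexp2l //.
      by apply/card_gt0P; exists (blank M).
    apply: pow_logM; apply: pow_logM.
    - exact: pow_log_const.
    - apply: pow_logM; apply: pow_logD; try exact: pow_log_const.
        exact: pow_log_id.
      exact: pow_log_poly.
    - by apply: pow_logD (pow_log_const _); apply: pow_log_explog.
    by apply: pow_logM (pow_log_const _); apply: pow_log_explog.
  have Np : pow_log N.
    apply: pow_logD (pow_log_const _); apply: pow_logM => //.
    by apply: (pow_log_le _ (pow_logD Tp (pow_log_const 1))) => n; rewrite addn1.
  apply: pow_logM (pow_log_const _) _; apply: pow_logM => //.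
  by apply: (pow_log_le _ (pow_logD Np (pow_log_const 2))) => n; rewrite addn2.
(* The product c e comes from depth [c * trunc_log 2 (t n)] with [t n <= 2 ^ (e * trunc_log 2 n)],
   and the 1 pays for the literals. *)
apply: (@NC1_of_formulas _ (c * e + 1) (n0 + n1 + 2)) => n le_n.
have l_gt0 : 0 < trunc_log 2 n by apply: log2_gt0; lia.
have [t0t ht] : t0 <= t n /\ 4 <= t n by rewrite /t /N; move: (T n * _) => u; nia.
have [C [dC Csol]] := prodC (t n) ht t0t.
have [||P [r [szP Peven Pval rA]]] := @machine_program M (adv n) n (s n) t0 A
  (t n) ht _ _ erefl.
- by move=> x <-; apply: MA.
- move=> x sx k; have := space x _ k; rewrite /s sx; move/(_ ltac:(lia)); lia.
have [f df fr] := program_formula Csol szP Peven Pval.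
exists f => [|x sx]; last by rewrite fr rA.
apply: leq_trans df _; rewrite mulnDl mul1n leq_add //.
apply: leq_trans dC _; rewrite -mulnA leq_mul2l; apply/orP; right.
by rewrite -[X in _ <= X](trunc_expnK _ (isT : 1 < 2)) leq_trunc_log // te //; lia.
Qed.

Theorem theorem3p1 :
  (exists c t0 : nat, forall (t : nat) (ht : 4 <= t), t0 <= t ->
     exists C : circuit (code_size t),
       circuit_depth C <= c * trunc_log 2 t /\
       solves_product (perm12_34 ht) C) ->
  forall A : language, NC1 A <-> L_nonuniform A.
Proof. by move=> prodC A; split; [apply: NC1_sub_L | apply: L_sub_NC1]. Qed.
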